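(* Let $u_0:=1$ and, for any $n\in\mathbb{N}^*$, let $u_n:=|\mathcal{P}_n|$ be the cardinality of the set $\mathcal{P}_n=\bigcup_{\varepsilon\in\{-1,1\}^{2n}_+}\mathcal{P}_n(\varepsilon)$ of pair partitions of $\{1,\ldots,2n\}$. Then $\{u_n\}_{n\in\mathbb{N}}$ satisfies the system $$u_{n+1}=\sum_{m=0}^{n}\binom{2m}{m}u_{n-m},\qquad\forall n\in\mathbb{N},$$ with the initial condition $u_0=1$. Moreover, the $u_n$ take the form $$u_0=u_1=1,\qquad u_n=f_n+g_n+\sum_{m=1}^{n-1}f_{n-m}g_m,\quad\forall n\ge2,$$ where, for any $n\in\mathbb{N}^*$, $$f_n:=\sum_{\substack{1\le m\le n+1\\ m\text{ odd}}}\binom{n+1}{m}2^{n+1-m}\cdot5^{\frac{m-1}{2}},\qquad g_n:=\begin{cases}-3,&\text{if }n=1,\\ -2C_{n-2},&\text{if }n\ge2.\end{cases}$$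
   Context: Conventions: $\mathbb{N}=\{0,1,2,\ldots\}$, $\mathbb{N}^*=\{1,2,\ldots\}$; $C_k=\frac{1}{k+1}\binom{2k}{k}$ is the $k$-th Catalan number ($C_0=1$). For $n\in\mathbb{N}^*$, $$\{-1,1\}^{2n}_+:=\Big\{\varepsilon:\{1,\ldots,2n\}\to\{-1,1\}:\ \sum_{h=1}^{2n}\varepsilon(h)=0,\ \sum_{h=p}^{2n}\varepsilon(h)\ge0\ \ \forall p\in\{1,\ldots,2n\}\Big\}.$$ Let $V=\{v_1<\cdots<v_{2k}\}$ be a finite totally ordered set with $2k$ elements. A pair partition of $V$ is a collection of pairs $\{(v_{i_h},v_{j_h})\}_{h=1}^k$ with $\{i_h,j_h:h=1,\ldots,k\}=\{1,\ldots,2k\}$, $1=i_1<\cdots<i_k$ and $i_h<j_h$ for all $h$; the $v_{i_h}$ are its left elements and the $v_{j_h}$ its right elements. It is non-crossing if for all $1\le s<h\le k$: $i_s<i_h<j_s\iff i_s<j_h<j_s$. $PP(V)$ denotes the set of all pair partitions of $V$. For $\varepsilon:V\to\{-1,1\}$, $PP(V,\varepsilon)$ is the set of pair partitions in $PP(V)$ such that $\varepsilon=-1$ on all left elements and $\varepsilon=1$ on all right elements. For $\varepsilon\in\{-1,1\}^{2n}_+$ there is exactly one non-crossing pair partition $\{(l^\varepsilon_h,r^\varepsilon_h)\}_{h=1}^n$ of $\{1,\ldots,2n\}$ in $PP(\{1,\ldots,2n\},\varepsilon)$. The depth of its pair $(l^\varepsilon_k,r^\varepsilon_k)$ is $d_\varepsilon(l^\varepsilon_k,r^\varepsilon_k):=|\{h:l^\varepsilon_h<l^\varepsilon_k<r^\varepsilon_k<r^\varepsilon_h\}|$.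 Put $V^\varepsilon_{0,1}:=\{l^\varepsilon_h,r^\varepsilon_h:\ d_\varepsilon(l^\varepsilon_h,r^\varepsilon_h)\in\{0,1\}\}$ (with the order induced from $\{1,\ldots,2n\}$) and let $\varepsilon_{0,1}$ be the restriction of $\varepsilon$ to $V^\varepsilon_{0,1}$. Then $\mathcal{P}_n(\varepsilon)$ is the set of all pair partitions of $\{1,\ldots,2n\}$ consisting of all the pairs $(l^\varepsilon_h,r^\varepsilon_h)$ with $d_\varepsilon(l^\varepsilon_h,r^\varepsilon_h)\ge2$ together with the pairs of an arbitrary element of $PP(V^\varepsilon_{0,1},\varepsilon_{0,1})$. Finally, $\mathcal{P}_n:=\bigcup_{\varepsilon\in\{-1,1\}^{2n}_+}\mathcal{P}_n(\varepsilon)$. *)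

(* Defs.v *)
From mathcomp Require Import all_boot all_order all_algebra.
Set Implicit Arguments.
Unset Strict Implicit.
Unset Printing Implicit Defensive.
Import GRing.Theory Num.Theory.

(* The ground set {1, ..., 2n} is represented by 'I_(n.*2), i.e. positions are
   counted from 0; only the order of the positions matters. *)

Definition sign_type : finType := seq_sub [:: -1; 1 : int]%R.

Section PairPartitions.
Variable N : nat.
Implicit Types (V : {set 'I_N}) (P Q : {set 'I_N * 'I_N}).
Implicit Types (e : {ffun 'I_N -> sign_type}).

Definition left_elts P : {set 'I_N} := [set p.1 | p in P].
Definition right_elts P : {set 'I_N} := [set p.2 | p in P].

(* A family of k pairs whose 2k endpoints exhaust a set of 2k elements: by
   counting, the endpoints are then pairwise distinct, and listing the pairs by
   increasing left elements is the enumeration 1 = i_1 < ... < i_k. *)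
Definition is_pair_partition V P : bool :=
  [&& #|V| == #|P|.*2,
      left_elts P :|: right_elts P == V
    & [forall p in P, p.1 < p.2]].

Definition PP V : {set {set 'I_N * 'I_N}} := [set P | is_pair_partition V P].

(* Only the values of e on V matter, so no explicit restriction is needed. *)
Definition PPsign V e : {set {set 'I_N * 'I_N}} :=
  [set P in PP V | [forall x in left_elts P, val (e x) == -1]%R
                && [forall x in right_elts P, val (e x) == 1]%R].

(* For p = (i_s, j_s) and q = (i_h, j_h), s < h means p.1 < q.1. *)
Definition noncrossing P : bool :=
  [forall p in P, forall q in P, (p.1 < q.1) ==>
     ((p.1 < q.1 < p.2) == (p.1 < q.2 < p.2))].

Definition balanced e : bool :=
  (\sum_h val (e h) == 0)%R
  && [forall p : 'I_N, 0 <= \sum_(h : 'I_N | (p <= h)%N) val (e h)]%R.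

(* The non-crossing element of PP({1, ..., 2n}, e); it exists and is unique
   when e is balanced, and the default set0 is used only for other e. *)
Definition nc_pp e : {set 'I_N * 'I_N} :=
  odflt set0 [pick P in PPsign [set: 'I_N] e | noncrossing P].

Definition depth e (p : 'I_N * 'I_N) : nat :=
  #|[set q in nc_pp e | [&& q.1 < p.1, p.1 < p.2 & p.2 < q.2]]|.

Definition V01 e : {set 'I_N} :=
  \bigcup_(p in nc_pp e | depth e p \in [:: 0; 1]) [set p.1; p.2].

Definition Psign e : {set {set 'I_N * 'I_N}} :=
  [set [set p in nc_pp e | 2 <= depth e p] :|: Q | Q in PPsign (V01 e) e].

End PairPartitions.

Definition signs_plus (n : nat) : {set {ffun 'I_(n.*2) -> sign_type}} :=
  [set e | balanced e].

Definition Pn (n : nat) : {set {set 'I_(n.*2) * 'I_(n.*2)}} :=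
  \bigcup_(e in signs_plus n) Psign e.

Definition u (n : nat) : nat := if n == 0 then 1 else #|Pn n|.

Definition catalan (k : nat) : nat := 'C(k.*2, k) %/ k.+1.

(* The division above is exact. *)
Lemma catalan_mul (k : nat) : catalan k * k.+1 = 'C(k.*2, k).
Proof.
apply: divnK; have := mul_bin_left k.*2 k.
rewrite -addnn addnK => E.
by rewrite -(Gauss_dvdr _ (coprimeSn k)) -E dvdn_mulr.
Qed.

(* f and g are meant for n >= 1 only. For odd m, m.-1./2 = (m - 1) / 2. *)
Definition f (n : nat) : int :=
  (\sum_(1 <= m < n.+2 | odd m)
     ('C(n.+1, m) * 2 ^ (n.+1 - m) * 5 ^ (m.-1)./2)%N%:Z)%R.

Definition g (n : nat) : int :=
  (if n == 1%N then - 3 else - 2 * (catalan (n - 2))%:Z)%R.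

(* Main.v *)
Require Import Defs.
From mathcomp Require Import all_boot all_order all_algebra.
From mathcomp Require Import zify ring.
Set Implicit Arguments.
Unset Strict Implicit.
Unset Printing Implicit Defensive.
Import GRing.Theory Num.Theory.

(** Call a position an opener or a closer according to its sign, -1 or 1, and
    let the height of a position be the number of pairs still open just before
    it.  Balanced signs are then Dyck words, and the union defining [Pn] is
    disjoint, because a pair partition determines its signs ([Psign_signs]).

    The pair partitions of V compatible with given signs are counted by the
    product of the heights of the closers, each closer choosing its partner
    among the openers still available ([card_PPsign]).  In the non-crossing
    partition the closer of a pair of depth d has height d + 1, and discarding
    all pairs of depth at least 2 does not change the heights of the other
    closers ([height_depth]).  So a balanced e contributes the product, over
    its closers, of the weight h if h <= 2 and 1 otherwise
    ([card_PPsign_V01]), and u n is a weighted count of Dyck paths of length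
    2n in which only the steps from 2 to 1 have a weight, 2, other than 1
    ([u_paths]).

    Cutting such a path at its first return to 0 leaves, above level 1, a path
    whose steps down to the new ground level weigh 2.  Doubling those steps
    counts the ways of reflecting each excursion, so these paths are as
    numerous as the unrestricted walks returning to 0: 'C(2m, m) of them for
    length 2m ([paths_free]).  This is the recurrence.

    For the closed form let b, c and U be the generating series of the central
    binomial coefficients, of the Catalan numbers and of u.  The recurrence
    reads U = 1 + x b U.  As b^2 = 1 / (1 - 4x) ([conv_cbin]) and
    (1 - 4x) b = 1 - 2 x c ([cbin_catalan]), eliminating b U between this
    equation and b U = b + x b^2 U gives (1 - 4x - x^2) U = 1 - 3x - 2 x^2 c
    ([cbin_recurrence]).  The right-hand side is 1 + sum g_n x^n, and
    1 / (1 - 4x - x^2) is 1 + sum f_n x^n since f satisfies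
    f_(n+2) = 4 f_(n+1) + f_n ([f_recurrence]). *)

(** * Pair partitions with prescribed signs *)

(** The height of a closer if its pair has depth 0 or 1, and 1, the number of
    choices left by a pair that stays in place, if the pair is deeper. *)
Definition weight01 (h : nat) : nat := if h <= 2 then h else 1.

Section Matchings.
Variable N : nat.
Implicit Types (V : {set 'I_N}) (P Q S : {set 'I_N * 'I_N}).
Implicit Types (e : {ffun 'I_N -> sign_type}) (p q : 'I_N * 'I_N).

Definition closes e (x : 'I_N) : bool := (val (e x) == 1)%R.

Definition openers V e := [set x in V | ~~ closes e x].
Definition closers V e := [set x in V | closes e x].

Lemma sign_opens (s : sign_type) : (val s == -1)%R = ~~ (val s == 1)%R.
Proof. by have := valP s; rewrite !inE => /orP[] /eqP->. Qed.

Lemma card_openers_closers V e : #|V| = #|openers V e| + #|closers V e|.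
Proof.
rewrite -(cardsID (closers V e) V) addnC; congr (_ + _); apply: eq_card => x.
  by rewrite !inE; case: (x \in V) => //=; rewrite andbT.
by rewrite !inE; case: (x \in V).
Qed.

(** With k openers, l closers and k + l = 2|P|, the bounds k, l <= |P| are
    equalities, so both endpoint maps are injective. *)
Lemma PPsignP V e P :
  reflect [/\ {in P &, injective fst}, {in P &, injective snd},
              fst @: P = openers V e, snd @: P = closers V e
            & {in P, forall p, p.1 < p.2}]
          (P \in PPsign V e).
Proof.
rewrite !inE /is_pair_partition /left_elts /right_elts.
apply: (iffP idP); last first.
  case=> inj1 inj2 E1 E2 lt12.
  have c1 : #|openers V e| = #|P| by rewrite -E1 card_in_imset.
  have c2 : #|closers V e| = #|P| by rewrite -E2 card_in_imset.
  rewrite (card_openers_closers V e) c1 c2 addnn eqxx E1 E2 /=.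
  apply/andP; split; [apply/andP; split|apply/andP; split].
  - apply/eqP/setP => x; rewrite !inE.
    by case: (x \in V) => //=; rewrite orNb.
  - by apply/forall_inP => p /lt12.
  - by apply/forall_inP => x; rewrite inE sign_opens => /andP[].
  - by apply/forall_inP => x; rewrite inE => /andP[].
move=> /andP[/and3P[/eqP cV /eqP UV /forall_inP lt12]].
move=> /andP[/forall_inP L /forall_inP R].
have E1 : fst @: P = openers V e.
  apply/setP => x; rewrite inE -UV inE; apply/idP/idP => [xP|].
    by rewrite xP /= -sign_opens L.
  by case/andP => /orP[//|/R xR]; rewrite /closes xR.
have E2 : snd @: P = closers V e.
  apply/setP => x; rewrite inE -UV inE; apply/idP/idP => [xP|].
    by rewrite xP orbT; apply: R.
  by case/andP => /orP[/L|//]; rewrite sign_opens /closes => /negbTE->.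
have le1 : #|fst @: P| <= #|P| by apply: leq_imset_card.
have le2 : #|snd @: P| <= #|P| by apply: leq_imset_card.
have := card_openers_closers V e; rewrite -E1 -E2 cV => cP.
have [c1 c2] : #|fst @: P| = #|P| /\ #|snd @: P| = #|P|.
  by move: le1 le2 cP; move: #|fst @: P| #|snd @: P| #|P| => a b c; lia.
by split=> //; apply/imset_injP; rewrite ?c1 ?c2.
Qed.

Lemma PPsign_fst V e P p : P \in PPsign V e -> p \in P ->
  p.1 \in V /\ ~~ closes e p.1.
Proof.
case/PPsignP => _ _ E _ _ /(imset_f fst); rewrite E inE.
by case/andP.
Qed.

Lemma PPsign_snd V e P p : P \in PPsign V e -> p \in P ->
  p.2 \in V /\ closes e p.2.
Proof.
case/PPsignP => _ _ _ E _ /(imset_f snd); rewrite E inE.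
by case/andP.
Qed.

(** The number of pairs of any compatible partition of V that are open just
    before x, read off the signs alone. *)
Definition height V e (x : 'I_N) : nat :=
  #|[set y in openers V e | y < x]| - #|[set y in closers V e | y < x]|.

(** A pair that is closed before x was also opened before x, so the truncated
    subtraction defining the height counts the pairs straddling x. *)
Lemma PPsign_height V e P x : P \in PPsign V e ->
  height V e x = #|[set q in P | q.1 < x <= q.2]|.
Proof.
case/PPsignP => inj1 inj2 E1 E2 lt12.
pose before (h : 'I_N * 'I_N -> 'I_N) := [set q in P | h q < x].
have sub h : before h \subset P by apply/subsetP => q; rewrite inE => /andP[].
have im h : h @: before h = [set y in h @: P | y < x].
  apply/setP => y; rewrite inE; apply/imsetP/andP.
    by case=> q; rewrite inE => /andP[qP qx] ->; rewrite imset_f.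
  case=> /imsetP[q qP ->] qx; exists q => //.
  by rewrite inE qP.
rewrite /height -E1 -E2 -!im.
rewrite (card_in_imset (sub_in2 (subsetP (sub fst)) inj1)).
rewrite (card_in_imset (sub_in2 (subsetP (sub snd)) inj2)).
have /setIidPr sub21 : before snd \subset before fst.
  apply/subsetP => q; rewrite !inE => /andP[qP qx]; rewrite qP /=.
  exact: ltn_trans (lt12 _ qP) qx.
rewrite -(cardsID (before snd) (before fst)) sub21 addKn.
apply: eq_card => q; rewrite !inE; case: (q \in P) => //=.
by rewrite -leqNgt andbC.
Qed.

Definition endpoints S : {set 'I_N} :=
  [set p.1 | p in S] :|: [set p.2 | p in S].

Lemma PPsign_sub V e P S : P \in PPsign V e -> S \subset P ->
  S \in PPsign (endpoints S) e.
Proof.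
move=> PV /subsetP SP; case/PPsignP: (PV) => inj1 inj2 _ _ lt12.
apply/PPsignP; split.
- exact: sub_in2 inj1.
- exact: sub_in2 inj2.
- apply/setP => x; rewrite !inE; apply/idP/idP => [xS|].
    rewrite xS /=; case/imsetP: xS => p /SP pP ->.
    by case: (PPsign_fst PV pP).
  case/andP=> /orP[//|/imsetP[p /SP pP ->]].
  by case: (PPsign_snd PV pP) => _ ->.
- apply/setP => x; rewrite !inE; apply/idP/idP => [xS|].
    rewrite xS orbT /=; case/imsetP: xS => p /SP pP ->.
    by case: (PPsign_snd PV pP).
  case/andP=> /orP[/imsetP[p /SP pP ->]|//].
  by case: (PPsign_fst PV pP) => _ /negbTE->.
- by move=> p /SP/lt12.
Qed.

Lemma PPsign_D1 V e P p : P \in PPsign V e -> p \in P ->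
  P :\ p \in PPsign (V :\: [set p.1; p.2]) e.
Proof.
move=> PV pP; have sPP : P :\ p \subset P by apply: subD1set.
suff -> : V :\: [set p.1; p.2] = endpoints (P :\ p) by apply: PPsign_sub PV _.
have [p1V p1o] := PPsign_fst PV pP; have [p2V p2c] := PPsign_snd PV pP.
case/PPsignP: (PV) => inj1 inj2 E1 E2 lt12.
apply/setP => x; rewrite !inE; apply/idP/idP.
  case/andP; rewrite negb_or => /andP[x1 x2] xV.
  have : x \in openers V e :|: closers V e.
    by rewrite !inE xV /= orNb.
  rewrite -E1 -E2 inE => /orP[] /imsetP[q qP xq]; apply/orP.
    left; rewrite xq imset_f // !inE qP andbT.
    by apply: contraNneq x1 => <-; rewrite xq.
  right; rewrite xq imset_f // !inE qP andbT.
  by apply: contraNneq x2 => <-; rewrite xq.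
case/orP=> /imsetP[q]; rewrite !inE => /andP[qp qP] ->.
  have [q1V q1o] := PPsign_fst PV qP.
  rewrite q1V andbT negb_or; apply/andP; split.
    by apply: contraNneq qp => /inj1->.
  by apply: contraNneq q1o => ->.
have [q2V q2c] := PPsign_snd PV qP.
rewrite q2V andbT negb_or; apply/andP; split.
  by apply: contraNneq p1o => <-.
by apply: contraNneq qp => /inj2->.
Qed.

Lemma PPsign_U1 V e Q p : p.1 \in V -> p.2 \in V ->
  ~~ closes e p.1 -> closes e p.2 -> p.1 < p.2 ->
  Q \in PPsign (V :\: [set p.1; p.2]) e -> p |: Q \in PPsign V e.
Proof.
move=> p1V p2V p1o p2c lt_p QV; case/PPsignP: (QV) => inj1 inj2 E1 E2 lt12.
have p12 : p.1 != p.2 by rewrite neq_ltn lt_p.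
have Q1 q : q \in Q -> q.1 <> p.1.
  by case/(PPsign_fst QV) => + _ qp; rewrite qp !inE eqxx.
have Q2 q : q \in Q -> q.2 <> p.2.
  by case/(PPsign_snd QV) => + _ qp; rewrite qp !inE eqxx orbT.
apply/PPsignP; split.
- move=> q r; rewrite !inE => /predU1P[->|qQ] /predU1P[->|rQ] //.
  + by move/esym/Q1.
  + by move/Q1.
  + exact: inj1.
- move=> q r; rewrite !inE => /predU1P[->|qQ] /predU1P[->|rQ] //.
  + by move/esym/Q2.
  + by move/Q2.
  + exact: inj2.
- rewrite imsetU1 E1; apply/setP => x; rewrite !inE negb_or.
  have [->|x1] := eqVneq x p.1; first by rewrite p1V p1o.
  by have [->|//] := eqVneq x p.2; rewrite p2c !andbF.
- rewrite imsetU1 E2; apply/setP => x; rewrite !inE negb_or.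
  have [->|x2] := eqVneq x p.2; first by rewrite p2V p2c.
  by have [->|//] := eqVneq x p.1; rewrite (negbTE p1o) !andbF.
- by move=> q; rewrite !inE => /predU1P[->|/lt12].
Qed.

Lemma openers_remove V e (l r : 'I_N) : ~~ closes e l -> closes e r ->
  openers (V :\: [set l; r]) e = openers V e :\ l.
Proof.
move=> lo rc; apply/setP => x; rewrite !inE.
by have [->|_] := eqVneq x r; rewrite ?rc ?orbT ?andbF // orbF -andbA.
Qed.

Lemma closers_remove V e (l r : 'I_N) : ~~ closes e l -> closes e r ->
  closers (V :\: [set l; r]) e = closers V e :\ r.
Proof.
move=> lo rc; apply/setP => x; rewrite !inE.
by have [->|_] := eqVneq x l; rewrite ?(negbTE lo) ?andbF // -andbA.
Qed.

Lemma height_remove V e (l r x : 'I_N) :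
  l \in openers V e -> r \in closers V e ->
  l < x -> r < x -> height (V :\: [set l; r]) e x = height V e x.
Proof.
rewrite !inE => /andP[lV lo] /andP[rV rc] lx rx.
rewrite /height openers_remove // closers_remove //.
have before (A : {set 'I_N}) (y : 'I_N) : y \in A -> y < x ->
    #|[set z in A | z < x]| = #|[set z in A :\ y | z < x]|.+1.
  move=> yA yx; rewrite (cardsD1 y) inE yA yx add1n; congr S.
  by apply: eq_card => z; rewrite !inE andbA.
rewrite (before (openers V e) l) ?inE ?lV //.
by rewrite (before (closers V e) r) ?inE ?rV //.
Qed.

Lemma first_closer V e : 0 < #|closers V e| ->
  exists2 r, r \in closers V e & {in closers V e, forall x : 'I_N, r <= x}.
Proof.
case/card_gt0P => r0 r0c.
by case: (arg_minnP (fun x : 'I_N => x : nat) r0c) => r rc rmin; exists r.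
Qed.

Lemma height_first_closer V e (r : 'I_N) :
  {in closers V e, forall x : 'I_N, r <= x} ->
  height V e r = #|[set y in openers V e | y < r]|.
Proof.
move=> rmin; rewrite /height.
suff -> : [set y in closers V e | y < r] = set0 by rewrite cards0 subn0.
apply/setP => y; rewrite inE [RHS]inE.
by apply/negP => /andP[/rmin]; rewrite leqNgt => /negP.
Qed.

(** Adding the pair (l, r) is injective, because no partition of the remaining
    points contains it. *)
Lemma PPsign_count_pair V e (l r : 'I_N) :
  l \in openers V e -> r \in closers V e -> l < r ->
  #|[set P in PPsign V e | (l, r) \in P]| = #|PPsign (V :\: [set l; r]) e|.
Proof.
rewrite !inE => /andP[lV lo] /andP[rV rc] lr.
have notin Q : Q \in PPsign (V :\: [set l; r]) e -> (l, r) \notin Q.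
  by move=> QV; apply/negP => /(PPsign_fst QV)[]; rewrite !inE eqxx.
rewrite -(@card_in_imset _ _ (fun Q => (l, r) |: Q)
  (PPsign (V :\: [set l; r]) e)).
  apply: eq_card => P; rewrite inE; apply/andP/imsetP => [[PV lrP]|[Q QV ->]].
    by exists (P :\ (l, r)); [apply: (PPsign_D1 PV lrP) | rewrite setD1K].
  by rewrite setU11 (PPsign_U1 (p := (l, r))).
by move=> Q R /notin Q0 /notin R0 QR; rewrite -(setU1K Q0) QR setU1K.
Qed.

(** Let r be the first closer.  It may be paired with any opener before it,
    which gives as many choices as its height; removing it together with its
    partner leaves the heights of the later closers unchanged. *)
Lemma card_PPsign V e : #|openers V e| = #|closers V e| ->
  #|PPsign V e| = \prod_(x in closers V e) height V e x.
Proof.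
move: {2}#|closers V e| (erefl #|closers V e|) => n.
elim: n V => [|n IH] V cn oc.
  have /cards0_eq V0 : #|V| = 0 by rewrite (card_openers_closers V e) oc cn.
  rewrite big_pred0 => [|x]; last first.
    by move/cards0_eq: cn => ->; rewrite inE.
  apply/eqP/cards1P; exists set0; apply/setP => P; rewrite inE.
  apply/idP/eqP => [PV|->].
    apply/setP => p; rewrite inE; apply/negP => /(PPsign_fst PV)[].
    by rewrite V0 inE.
  have E0 : openers V e = set0 /\ closers V e = set0.
    by split; apply/setP => x; rewrite !inE V0 inE.
  apply/PPsignP; rewrite !imset0 E0.1 E0.2.
  by split=> // [p|p|p]; rewrite inE.
have [r rc rmin] : exists2 r, r \in closers V e
  & {in closers V e, forall x : 'I_N, r <= x}
  by apply: first_closer; rewrite cn.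
pose B := [set y in openers V e | y < r].
(* The partner of r sorts the partitions into disjoint classes. *)
have partner P : P \in PPsign V e -> \sum_(l in B | (l, r) \in P) 1 = 1.
  move=> PV; case/PPsignP: (PV) => _ inj2 _ E2 lt12.
  have := rc; rewrite -E2 => /imsetP[[l r'] lrP /= rr']; subst r'.
  rewrite (big_pred1 l) // => k /=; apply/andP/eqP => [[_ krP]|->].
    by have [] := inj2 _ _ krP lrP (erefl _).
  by have [lV lo] := PPsign_fst PV lrP; rewrite !inE lV lo (lt12 _ lrP).
rewrite (big_setD1 r) //= height_first_closer // -/B.
have -> : #|PPsign V e| = \sum_(P in PPsign V e) \sum_(l in B | (l, r) \in P) 1.
  by rewrite -sum1_card; apply/esym/eq_bigr => P; apply: partner.
rewrite (exchange_big_dep (mem B)) /=; last first.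
  by move=> P l _ /andP[].
rewrite -sum_nat_const; apply: eq_bigr => l lB.
have := lB; rewrite inE => /andP[lo lr].
have [[lV lo'] [rV rc']] :
    (l \in V /\ ~~ closes e l) /\ (r \in V /\ closes e r).
  by move: lo rc; rewrite !inE => /andP[? ?] /andP[? ?].
rewrite (eq_bigl (fun P => (P \in PPsign V e) && ((l, r) \in P))); last first.
  by move=> P; rewrite lo lr.
rewrite sum1dep_card PPsign_count_pair // IH.
- rewrite closers_remove //; apply: eq_bigr => x; rewrite !inE => /andP[xr xc].
  have rx : r < x by rewrite ltn_neqAle eq_sym xr rmin // inE.
  by rewrite height_remove // (ltn_trans lr).
- by move: cn; rewrite closers_remove // (cardsD1 r) rc => -[].
- rewrite closers_remove // openers_remove //.
  by move: oc; rewrite (cardsD1 l) lo [in RHS](cardsD1 r) rc => -[].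
Qed.

(** Pairing the first closer r with the last opener l before it leaves no point
    of V between l and r, so this pair crosses nothing. *)
Lemma noncrossing_exists V e : #|openers V e| = #|closers V e| ->
  {in closers V e, forall x, 0 < height V e x} ->
  exists2 P, P \in PPsign V e & noncrossing P.
Proof.
move: {2}#|closers V e| (erefl #|closers V e|) => n.
elim: n V => [|n IH] V cn oc hgt0.
  have := card_PPsign oc; rewrite big_pred0 => [/eqP/cards1P[P PV]|x];
    last first.
    by move/cards0_eq: cn => ->; rewrite inE.
  exists P; first by rewrite PV set11.
  have := set11 P; rewrite -PV => /PPsignP[_ _ _ E2 _].
  move/cards0_eq: cn; rewrite -E2 => /eqP; rewrite imset_eq0 => /eqP->.
  by apply/forall_inP => p; rewrite inE.
have [r rc rmin] : exists2 r, r \in closers V e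
  & {in closers V e, forall x : 'I_N, r <= x}
  by apply: first_closer; rewrite cn.
have := hgt0 _ rc; rewrite height_first_closer // => /card_gt0P[l0 l0B].
case: (arg_maxnP (fun x : 'I_N => x : nat) l0B) => l lB lmax.
have : l \in [set y in openers V e | y < r] by [].
rewrite inE => /andP[lo lr].
have := lo; have := rc; rewrite !inE => /andP[rV rc'] /andP[lV lo'].
have gap y : y \in V -> ~~ (l < y < r).
  move=> yV; apply/negP => /andP[ly yr]; have [yc|yo] := boolP (closes e y).
    by have := rmin y; rewrite inE yV yc leqNgt yr => /(_ isT).
  have /lmax /= : y \in [set y in openers V e | y < r] by rewrite !inE yV yo yr.
  by rewrite leqNgt ly.
have [|||P PV ncP] := IH (V :\: [set l; r]).
- by move: cn; rewrite closers_remove // (cardsD1 r) rc => -[].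
- rewrite closers_remove // openers_remove //.
  by move: oc; rewrite (cardsD1 l) lo [in RHS](cardsD1 r) rc => -[].
- rewrite closers_remove // => x; rewrite in_setD1 => /andP[xr xc].
  have rx : r < x by rewrite ltn_neqAle eq_sym xr rmin.
  by rewrite height_remove ?hgt0 // (ltn_trans lr).
exists ((l, r) |: P); first exact: (PPsign_U1 (p := (l, r))).
(* No remaining point separates l from r. *)
have away y : y \in V :\: [set l; r] -> (l < y) = (r < y).
  rewrite !inE negb_or => /andP[/andP[_ yr] /gap].
  rewrite negb_and; have [ly /= yr'|//] := boolP (l < y).
    by apply/esym; rewrite ltn_neqAle eq_sym yr leqNgt.
  by move=> ly _; apply/esym/negbTE; apply: contra ly; apply: ltn_trans.
have PV1 q : q \in P -> (l < q.1) = (r < q.1).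
  by case/(PPsign_fst PV) => /away.
have PV2 q : q \in P -> (l < q.2) = (r < q.2).
  by case/(PPsign_snd PV) => /away.
have empty (x : 'I_N) : (r < x < r) = false.
  by apply/negP => /andP[rx /(ltn_trans rx)]; rewrite ltnn.
apply/forall_inP => p pP; apply/forall_inP => q qP; apply/implyP => pq.
move: pP qP pq; rewrite !inE => /predU1P[->|pP] /predU1P[->|qP] /=.
- by rewrite ltnn.
- by move=> _; rewrite PV1 // PV2 // !empty.
- by move=> pl; rewrite pl (ltn_trans pl lr) /= PV2.
- move=> pq; move/forall_inP/(_ _ pP)/forall_inP/(_ _ qP): ncP.
  by rewrite pq.
Qed.

Lemma PPsign_card V e P : P \in PPsign V e -> #|openers V e| = #|closers V e|.
Proof.
by case/PPsignP => inj1 inj2 <- <- _; rewrite !card_in_imset.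
Qed.

(** This is where non-crossing pairs are needed: a pair that is open just
    before p closes is p itself or encloses p. *)
Lemma noncrossing_covers V e P p q : P \in PPsign V e -> noncrossing P ->
  p \in P -> q \in P ->
  (q.1 < p.2 <= q.2) = (q == p) || (q.1 < p.1) && (p.2 < q.2).
Proof.
case/PPsignP => inj1 inj2 _ _ lt12 ncP pP qP.
have nc r s : r \in P -> s \in P -> r.1 < s.1 ->
    (s.1 < r.2) = (r.1 < s.2 < r.2).
  move=> rP sP rs.
  have /eqP := implyP (forall_inP (forall_inP ncP r rP) s sP) rs.
  by rewrite rs.
have [->|qp] := eqVneq q p; first by rewrite leqnn lt12.
have -> : (p.2 <= q.2) = (p.2 < q.2).
  rewrite ltn_neqAle andb_idl // => _.
  by apply: contraNneq qp => /val_inj/inj2->.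
case: (ltngtP q.1 p.1) => [qp1|pq1|/val_inj/inj1 E].
- by rewrite (ltn_trans qp1 (lt12 _ pP)).
- rewrite (nc _ _ pP qP pq1); apply/negbTE; rewrite negb_and -!leqNgt.
  by case: (ltnP p.2 q.2) => [/ltnW pq2|]; rewrite ?orbT // orbF leqNgt negb_and
    -!leqNgt pq2 orbT.
- by rewrite E ?eqxx in qp.
Qed.

Lemma sum_signs e (A : pred 'I_N) :
  (\sum_(h | A h) val (e h) = #|[set y in closers setT e | A y]|%:Z
                            - #|[set y in openers setT e | A y]|%:Z)%R.
Proof.
rewrite (bigID (closes e)) /=; congr (_ + _)%R.
  rewrite (eq_bigr (fun=> 1%R)) => [|h /andP[_ /eqP //]].
  rewrite sumr_const natz; congr Posz.
  by apply: eq_card => h; rewrite !inE andbC.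
rewrite (eq_bigr (fun=> - 1)%R) => [|h /andP[_]]; last first.
  by rewrite -sign_opens => /eqP.
rewrite sumr_const mulNrn natz; congr (- Posz _)%R.
by apply: eq_card => h; rewrite !inE andbC.
Qed.

Lemma card_before_from (A : {set 'I_N}) k :
  #|A| = #|[set y in A | y < k]| + #|[set y in A | k <= y]|.
Proof.
rewrite -(cardsID [set y : 'I_N | y < k]); congr (_ + _); apply: eq_card => y.
  by rewrite !inE.
by rewrite !inE -leqNgt andbC.
Qed.

Lemma card_before_S (A : {set 'I_N}) (x : 'I_N) :
  #|[set y in A | y < x.+1]| = (x \in A) + #|[set y in A | y < x]|.
Proof.
rewrite (cardsD1 x) !inE ltnSn andbT; congr (_ + _); apply: eq_card => y.
by rewrite !inE ltnS [y < x]ltn_neqAle andbCA.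
Qed.

(** Strict positivity of the heights at the closers is equivalent to the
    suffix sums being nonnegative: as the total is 0, these say that no prefix
    has more closers than openers, and this can first fail only at a closer
    preceded by as many openers as closers. *)
Lemma balancedE e : balanced e =
  (#|openers setT e| == #|closers setT e|)
  && [forall x in closers setT e, 0 < height setT e x].
Proof.
pose o k := #|[set y in openers setT e | y < k]|.
pose c k := #|[set y in closers setT e | y < k]|.
have total : (\sum_h val (e h) == 0)%R =
    (#|openers setT e| == #|closers setT e|).
  rewrite (sum_signs e xpredT) subr_eq0 eqz_nat eq_sym.
  by congr (_ == _); apply: eq_card => y; rewrite inE andbT.
rewrite /balanced total; have [oc /=|//] := eqVneq.
have suffix (p : 'I_N) :
    (0 <= \sum_(h : 'I_N | (p <= h)%N) val (e h))%R = (c p <= o p).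
  rewrite sum_signs subr_ge0 lez_nat.
  have := card_before_from (openers setT e) p.
  rewrite oc (card_before_from (closers setT e) p) -/(o p) -/(c p).
  move: (o p) (c p) => a b; move: #|_| #|_| => a' b'; lia.
under eq_forallb => p do rewrite suffix.
apply/forallP/forall_inP => [le_co x xc|gt0 p].
  (* Compare the prefix ending with x, which may be the whole word. *)
  rewrite subn_gt0 -/(o x) -/(c x).
  have -> : (c x).+1 = c x.+1 by rewrite /c card_before_S xc.
  have -> : o x = o x.+1.
    by rewrite /o card_before_S; move: xc; rewrite !inE /= => ->.
  have [xN|] := ltnP x.+1 N; first exact: (le_co (Ordinal xN)).
  move=> Nx; have full (A : {set 'I_N}) : #|[set y in A | y < x.+1]| = #|A|.
    apply: eq_card => y; rewrite !inE andb_idr // => _.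
    exact: leq_trans (ltn_ord y) Nx.
  by rewrite /c /o !full oc.
elim: {p}(p : nat) (ltn_ord p) => [_|k IH kN].
  by rewrite /c (_ : [set y in _ | _] = set0) ?cards0 //; apply/setP => y;
    rewrite !inE andbF.
have := IH (ltnW kN); pose x := Ordinal (ltnW kN).
rewrite /c /o -[k]/(x : nat) !card_before_S -/(c x) -/(o x).
have [xc _|_] := boolP (x \in closers setT e); last first.
  by rewrite add0n => /leq_trans; apply; apply: leq_addl.
by have := gt0 x xc; rewrite subn_gt0 => /leq_trans; apply; apply: leq_addl.
Qed.

Lemma nc_ppP e : balanced e ->
  nc_pp e \in PPsign [set: 'I_N] e /\ noncrossing (nc_pp e).
Proof.
rewrite balancedE => /andP[/eqP oc /forall_inP gt0].
have [P PT ncP] := noncrossing_exists oc gt0.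
rewrite /nc_pp; case: pickP => [Q /andP[]//|/(_ P)].
by rewrite PT ncP.
Qed.

Lemma depthE e p : nc_pp e \in PPsign setT e -> p \in nc_pp e ->
  depth e p = #|[set q in nc_pp e | (q.1 < p.1) && (p.2 < q.2)]|.
Proof.
move=> ncT pP; case/PPsignP: ncT => _ _ _ _ /(_ _ pP) lt_p.
by apply: eq_card => q; rewrite !inE lt_p.
Qed.

Lemma depth_encloses e p q : nc_pp e \in PPsign setT e ->
  p \in nc_pp e -> q \in nc_pp e -> q.1 < p.1 -> p.2 < q.2 ->
  depth e q < depth e p.
Proof.
move=> ncT pP qP qp1 pq2; rewrite !depthE //.
apply: proper_card; apply/properP; split.
  apply/subsetP => r; rewrite !inE => /and3P[-> rq1 qr2].
  by rewrite (ltn_trans rq1 qp1) (ltn_trans pq2 qr2).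
by exists q; rewrite !inE qP ?qp1 ?pq2 // ltnn.
Qed.

(** The set S is either the whole non-crossing partition or its shallow part.
    In both cases it contains the pairs enclosing any of its members, and these
    are exactly the other pairs open when p closes. *)
Lemma height_depth e S p : nc_pp e \in PPsign setT e -> noncrossing (nc_pp e) ->
  S \subset nc_pp e -> p \in S ->
  {in nc_pp e, forall q, q.1 < p.1 -> p.2 < q.2 -> q \in S} ->
  height (endpoints S) e p.2 = (depth e p).+1.
Proof.
move=> ncT ncP SP pS up; rewrite (PPsign_height _ (PPsign_sub ncT SP)).
have pP := subsetP SP _ pS.
rewrite (cardsD1 p) inE pS /= (noncrossing_covers ncT) //.
rewrite eqxx add1n; congr _.+1.
rewrite depthE //; apply: eq_card => q; rewrite !inE.
have [qS|qS] := boolP (q \in S).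
  have qP := subsetP SP _ qS.
  rewrite (noncrossing_covers ncT) // qP; have [->|//] := eqVneq q p.
  by rewrite ltnn.
rewrite andbF; apply/esym/negP => /and3P[qP qp1 pq2].
by rewrite up in qS.
Qed.

Definition shallow e := [set p in nc_pp e | depth e p <= 1].

Lemma V01_endpoints e : V01 e = endpoints (shallow e).
Proof.
have mem01 d : (d \in [:: 0; 1]) = (d <= 1) by rewrite !inE; case: d => [|[]].
apply/setP => x; rewrite inE; apply/bigcupP/orP.
  case=> p /andP[pP]; rewrite mem01 => dp; rewrite !inE => /orP[] /eqP->.
    by left; rewrite imset_f // inE pP.
  by right; rewrite imset_f // inE pP.
by case=> /imsetP[p]; rewrite inE => /andP[pP dp] ->; exists p;
  rewrite ?pP ?mem01 ?dp // !inE eqxx ?orbT.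
Qed.

Lemma endpoints_full V e P : P \in PPsign V e -> endpoints P = V.
Proof.
case/PPsignP => _ _ E1 E2 _; rewrite /endpoints E1 E2.
by apply/setP => x; rewrite !inE -andb_orr orNb andbT.
Qed.

(** Pairs enclosing a shallow pair are less deep, hence shallow: the height of a
    shallow closer is the same in V01 as in the whole word, namely the depth of
    its pair plus 1. *)
Lemma card_PPsign_V01 e : balanced e ->
  #|PPsign (V01 e) e| =
  \prod_(x in closers setT e) weight01 (height setT e x).
Proof.
case/nc_ppP => ncT ncP.
have sub : shallow e \subset nc_pp e.
  by apply/subsetP => p; rewrite inE => /andP[].
have shV := PPsign_sub ncT sub.
rewrite V01_endpoints card_PPsign ?(PPsign_card shV) //.
case/PPsignP: shV => _ inj2S _ E2S _; rewrite -E2S big_imset //=.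
case/PPsignP: (ncT) => _ inj2 _ E2 _; rewrite -E2 big_imset //=.
rewrite [RHS](big_setID (shallow e)) /= (setIidPr sub).
rewrite [X in _ * X]big1 ?muln1 => [|p].
  apply: eq_bigr => p pS; have pP := subsetP sub _ pS.
  have /andP[_ dp] : (p \in nc_pp e) && (depth e p <= 1) by rewrite inE in pS.
  rewrite -(endpoints_full ncT) !height_depth // /weight01 ?ltnS ?dp //.
  move=> q qP qp1 pq2; rewrite inE qP.
  by apply: ltnW; apply: leq_trans dp; apply: depth_encloses.
rewrite !inE => /andP[+ pP]; rewrite pP /= => /negbTE dp.
by rewrite -{1}(endpoints_full ncT) height_depth // /weight01 ltnS dp.
Qed.

Definition sgn (b : bool) : sign_type :=
  insubd (SeqSub (mem_head (- 1)%R [:: 1%R])) (if b then 1 else - 1)%R.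

Lemma sgnE b : (val (sgn b) == 1)%R = b.
Proof. by rewrite /sgn val_insubd; case: b. Qed.

Lemma sgnK (s : sign_type) : sgn (val s == 1)%R = s.
Proof.
apply: val_inj; rewrite val_insubd; have := valP s; rewrite !inE.
by case/orP => /eqP->.
Qed.

Definition signs_of P : {ffun 'I_N -> sign_type} :=
  [ffun x => sgn (x \notin left_elts P)].

(** The left elements of the deep pairs together with those of a compatible
    partition of V01 are all the openers. *)
Lemma Psign_signs e P : balanced e -> P \in Psign e -> signs_of P = e.
Proof.
case/nc_ppP => ncT ncP /imsetP[Q QV ->].
apply/ffunP => x; rewrite ffunE -[RHS]sgnK; congr sgn.
apply/idP/idP; last first.
  move=> xc; apply/imsetP => -[p + xp]; rewrite !inE => /orP[/andP[pP _]|pQ].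
    by have [_] := PPsign_fst ncT pP; rewrite -xp /closes xc.
  by have [_] := PPsign_fst QV pQ; rewrite -xp /closes xc.
apply: contraR => xo; case/PPsignP: ncT => _ _ E1 _ _.
have : x \in openers setT e by rewrite !inE.
rewrite -E1 => /imsetP[p pP xp].
have [dp|dp] := leqP 2 (depth e p).
  by rewrite xp; apply: imset_f; rewrite !inE pP dp.
have : x \in openers (V01 e) e.
  rewrite inE [~~ _]xo andbT V01_endpoints inE xp imset_f //.
  by rewrite inE pP.
case/PPsignP: QV => _ _ <- _ _ /imsetP[q qQ ->].
by apply: imset_f; rewrite inE qQ orbT.
Qed.

(** A pair of the variable part has its endpoints in V01, so it is never one of
    the deep pairs: these can be subtracted again. *)
Lemma card_Psign e : balanced e -> #|Psign e| = #|PPsign (V01 e) e|.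
Proof.
case/nc_ppP => ncT ncP; apply: card_in_imset.
set D := [set p in nc_pp e | _].
have disj Q : Q \in PPsign (V01 e) e -> (D :|: Q) :\: D = Q.
  move=> QV; apply/setP => p; rewrite !inE.
  have [pQ|_] := boolP (p \in Q); last by rewrite orbF andNb.
  rewrite orbT andbT; apply/negP => /andP[pP dp].
  have [] := PPsign_fst QV pQ; rewrite V01_endpoints inE.
  case/PPsignP: (ncT) => inj1 _ _ _ _ /orP[] /imsetP[q];
    rewrite inE => /andP[qP dq] pq.
    by move: dq; rewrite -(inj1 _ _ pP qP pq) leqNgt dp.
  by have [_] := PPsign_snd ncT qP; rewrite -pq => ->.
by move=> Q R /disj QK /disj RK QR; rewrite -QK QR.
Qed.

End Matchings.

Lemma card_Pn n :
  #|Pn n| = \sum_(e in signs_plus n)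
              \prod_(x in closers setT e) weight01 (height setT e x).
Proof.
rewrite -sum1_card (partition_big (@signs_of _) (mem (signs_plus n))) /=.
  apply: eq_bigr => e; rewrite inE => eb.
  rewrite -card_PPsign_V01 // -card_Psign // -sum1_card.
  apply: eq_bigl => P; apply/andP/idP => [[/bigcupP[e']]|PP].
    by rewrite inE => eb' Pe' /eqP <-; rewrite (Psign_signs eb' Pe').
  split; last by rewrite (Psign_signs eb PP).
  by apply/bigcupP; exists e; rewrite ?inE.
by move=> P /bigcupP[e]; rewrite !inE => eb Pe; rewrite (Psign_signs eb Pe).
Qed.

(** * Weighted paths *)

(** The weighted number of paths of length N from height h to height 0, with
    steps 1 and -1, where a step from h to h - 1 weighs w h.  When w 0 = 0 the
    paths are nonnegative and the value of 0.-1 is irrelevant. *)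
Fixpoint paths (w : nat -> nat) (N h : nat) : nat :=
  if N is N'.+1 then paths w N' h.+1 + w h * paths w N' h.-1 else h == 0.

(** The weights seen by a path on or above level 1, measured from level 1. *)
Definition lift_weight (w : nat -> nat) (h : nat) : nat :=
  if h is 0 then 0 else w h.+1.

(** Cut at the first step from 1 to 0, taken at time i: before it the path stays
    on or above level 1. *)
Lemma paths_first_passage (w : nat -> nat) N h :
  paths w N h.+1 =
  \sum_(i < N) paths (lift_weight w) i h * (w 1 * paths w (N.-1 - i) 0).
Proof.
elim: N h => [|N IH] h; first by rewrite big_ord0.
rewrite big_ord_recl /= subn0 IH.
have shift (i : 'I_N) : N - bump 0 i = N.-1 - i by rewrite /bump /=; lia.
under [in RHS]eq_bigr => i _ do rewrite shift /= mulnDl.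
rewrite big_split /= addnCA; congr addn.
case: h => [|h] /=; first by rewrite mul1n big1 ?addn0.
rewrite mul0n add0n IH big_distrr /=; apply: eq_bigr => i _.
by rewrite mulnA.
Qed.

(** Unrestricted walks from h to 0 satisfy the same recursion up to a factor 2
    when h > 0: the weight 2 of the step from 1 to 0 restores this factor, and
    at h = 0 both first steps of the walk are represented by the upward one. *)
Lemma paths_free N h :
  paths (lift_weight weight01) N h =
  (if odd (N + h) then 0 else 'C(N, (N + h)./2)) * (if h is 0 then 1 else 2).
Proof.
elim: N h => [|N IH] [|h] /=; rewrite ?IH //.
- by case: ifP => //; case: h => // h _; rewrite bin0n.
- rewrite !addn0 addn1 /=; case: ifP => // oddN.
  have [k ->] : exists k, N = k.*2.+1.
    by exists N./2; rewrite -[LHS]odd_double_half (negbFE oddN).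
  rewrite uphalfE -doubleS doubleK muln1 [in RHS]binS.
  have -> : 'C(k.*2.+1, k) = 'C(k.*2.+1, k.+1).
    by rewrite -[RHS]bin_sub; [congr binomial; lia | lia].
  by rewrite muln2 -addnn.
- rewrite !addnS /= /= negbK.
  case: ifP => odd_Nh; first by case: h {odd_Nh} => [|h]; lia.
  case: h odd_Nh => [|h] odd_Nh /=.
    by rewrite addn0 binS muln1 mulnDl [weight01 2 * _]mulnC.
  by rewrite binS mul1n -mulnDl.
Qed.

Lemma sum_even_terms (F : nat -> nat) n :
  (forall i, odd i -> F i = 0) ->
  \sum_(i < n.*2.+1) F i = \sum_(0 <= m < n.+1) F m.*2.
Proof.
move=> F0; rewrite big_mkord; elim: n => [|n IH]; first by rewrite !big_ord1.
rewrite doubleS big_ord_recr big_ord_recr /= IH F0 /= ?odd_double // addn0.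
by rewrite [RHS]big_ord_recr.
Qed.

(** Only even excursion lengths contribute, by parity. *)
Lemma paths_weight01 n :
  paths weight01 n.+1.*2 0 =
  \sum_(0 <= m < n.+1) 'C(m.*2, m) * paths weight01 (n - m).*2 0.
Proof.
have free i : paths (lift_weight weight01) i 0
              = if odd i then 0 else 'C(i, i./2).
  by rewrite paths_free addn0 muln1.
rewrite doubleS -[LHS]/(paths weight01 n.*2.+1 1 + 0) addn0 paths_first_passage.
rewrite [LHS](@sum_even_terms (fun i => paths (lift_weight weight01) i 0 *
  (weight01 1 * paths weight01 (n.*2 - i) 0))) => [|i oddi].
  by apply: eq_bigr => m _; rewrite free odd_double doubleK mul1n doubleB.
by rewrite free oddi.
Qed.

(** * From signs to paths *)

(** The weight of the path starting at height h that goes up at each [false]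
    and down at each [true], or 0 unless it ends at height 0. *)
Definition word_weight (w : nat -> nat) (h : nat) (s : seq bool) : nat :=
  (h + count negb s == count id s) *
  \prod_(i < size s) (if nth false s i
     then w (h + count negb (take i s) - count id (take i s)) else 1).

Lemma word_weight_open w h s :
  word_weight w h (false :: s) = word_weight w h.+1 s.
Proof.
rewrite /word_weight /= add0n add1n addnS -addSn big_ord_recl /= mul1n.
by congr (_ * _); apply: eq_bigr => i _; rewrite /= add0n add1n addnS -addSn.
Qed.

(** At height 0 both sides vanish, the left one because the truncated
    subtraction yields the weight w 0. *)
Lemma word_weight_close w h s : w 0 = 0 ->
  word_weight w h (true :: s) = w h * word_weight w h.-1 s.
Proof.
move=> w0; rewrite /word_weight /= big_ord_recl /= addn0 subn0.
case: h => [|h]; first by rewrite w0 mul0n muln0.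
rewrite mulnCA add0n add1n addSn eqSS; congr (_ * (_ * _)).
Qed.

Lemma sum_tuple_cons N (F : seq bool -> nat) :
  \sum_(t : N.+1.-tuple bool) F t =
  \sum_(t : N.-tuple bool) F (false :: t) +
  \sum_(t : N.-tuple bool) F (true :: t).
Proof.
pose cons_pair (p : bool * N.-tuple bool) : N.+1.-tuple bool :=
  cons_tuple p.1 p.2.
rewrite (reindex cons_pair) /=.
  by rewrite -(pair_bigA _ (fun b (t : N.-tuple bool) => F (b :: t)))
    big_bool addnC.
exists (fun t => (thead t, behead_tuple t)) => [[b t] _|t _].
  by congr (_, _); apply: val_inj.
by apply: val_inj; rewrite [in RHS](tuple_eta t).
Qed.

Lemma sum_word_weight w N h : w 0 = 0 ->
  \sum_(t : N.-tuple bool) word_weight w h t = paths w N h.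
Proof.
move=> w0; elim: N h => [|N IH] h.
  rewrite (big_pred1 [tuple]) => [|t]; last by apply/esym/eqP; apply: tuple0.
  by rewrite /word_weight big_ord0 muln1 /= addn0.
rewrite sum_tuple_cons /= -!IH big_distrr; congr (_ + _); apply: eq_bigr => t _.
  exact: word_weight_open.
exact: word_weight_close.
Qed.

Lemma count_take (a : pred bool) s k :
  count a (take k s) = \sum_(i < size s) (a (nth false s i) && (i < k)).
Proof.
elim: s k => [|b s IH] [|k] /=; rewrite ?big_ord0 //.
  by rewrite big1 // => i _; rewrite andbF.
by rewrite big_ord_recl /= andbT IH.
Qed.

Lemma count_take_tuple N (t : N.-tuple bool) (a : pred bool) k :
  #|[set y : 'I_N | a (tnth t y) & y < k]| = count a (take k t).
Proof.
rewrite count_take size_tuple -sum1dep_card big_mkcond; apply: eq_bigr => i _.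
by rewrite (tnth_nth false); case: (_ && _).
Qed.

Lemma word_weight_heights w N (t : N.-tuple bool)
    (e : {ffun 'I_N -> sign_type}) :
  (forall i, closes e i = tnth t i) ->
  word_weight w 0 t = (#|openers setT e| == #|closers setT e|) *
                      \prod_(x in closers setT e) w (height setT e x).
Proof.
move=> et.
have openE k : count negb (take k t) = #|[set y in openers setT e | y < k]|.
  by rewrite -count_take_tuple; apply: eq_card => y; rewrite !inE et.
have closeE k : count id (take k t) = #|[set y in closers setT e | y < k]|.
  by rewrite -count_take_tuple; apply: eq_card => y; rewrite !inE et.
have all (A : {set 'I_N}) : #|[set y in A | y < N]| = #|A|.
  by apply: eq_card => y; rewrite !inE ltn_ord andbT.
rewrite /word_weight add0n -[X in count negb X]take_size.
rewrite -[X in count id X]take_size.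
rewrite openE closeE size_tuple !all; congr (_ * _).
rewrite [RHS]big_mkcond; apply: eq_bigr => i _.
by rewrite add0n openE closeE -tnth_nth -et !inE.
Qed.

(** A word with equally many openers and closers that is not balanced has a
    closer of height 0, whose weight kills the product; so summing over all
    words does no harm. *)
Lemma u_paths n : u n = paths weight01 n.*2 0.
Proof.
case: n => [//|n]; rewrite -[LHS]/#|Pn n.+1| card_Pn.
pose signs (t : n.+1.*2.-tuple bool) := [ffun i => sgn (tnth t i)].
rewrite -sum_word_weight // big_mkcond [LHS](reindex signs); last first.
  exists (fun e => [tuple closes e i | i < n.+1.*2]) => [t _|e _].
    by apply: eq_from_tnth => i; rewrite tnth_mktuple /closes ffunE sgnE.
  by apply/ffunP => i; rewrite ffunE tnth_mktuple sgnK.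
apply: eq_bigr => t _.
rewrite (@word_weight_heights _ _ t (signs t)); last first.
  by move=> i; rewrite /closes ffunE sgnE.
move: (signs t) => e; rewrite inE balancedE; case: eqVneq => _ //=.
rewrite mul1n; case: forall_inP => // gt0; apply/esym/eqP.
have [x xc hx] : exists2 x, x \in closers setT e & height setT e x == 0.
  apply/exists_inP; apply: contra_notT gt0; rewrite negb_exists_in.
  by move/forall_inP => h x /h; rewrite lt0n.
by rewrite (bigD1 x) //= (eqP hx) mul0n.
Qed.

(** * The closed form *)

Section Sequences.
Local Open Scope ring_scope.

Definition conv (a b : nat -> int) (n : nat) : int :=
  \sum_(i < n.+1) a i * b (n - i)%N.

(** Truncated power series are polynomials, which carry the ring structure
    that convolution inherits. *)
Lemma conv_coef (a b : nat -> int) (N n : nat) : (n < N)%N ->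
  conv a b n = (\poly_(i < N) a i * \poly_(i < N) b i)`_n.
Proof.
move=> nN; rewrite coefM; apply: eq_bigr => i _.
by rewrite !coef_poly !ifT //; have := ltn_ord i; lia.
Qed.

Lemma convA (a b c : nat -> int) n : conv a (conv b c) n = conv (conv a b) c n.
Proof.
pose p (a : nat -> int) := \poly_(i < n.+1) a i.
transitivity ((p a * (p b * p c))`_n); last rewrite mulrA.
  rewrite coefM; apply: eq_bigr => i _.
  have ilt := ltn_ord i.
  by rewrite coef_poly ifT // -conv_coef //; lia.
rewrite coefM; apply: eq_bigr => i _.
have ilt := ltn_ord i.
by rewrite [(p c)`_ _]coef_poly ifT -?conv_coef //; lia.
Qed.

Lemma conv_recl (a b : nat -> int) n :
  conv a b n.+1 = a 0%N * b n.+1 + conv (fun i => a i.+1) b n.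
Proof.
rewrite /conv big_ord_recl subn0; congr (_ + _).
Qed.

Lemma convC (a b : nat -> int) n : conv a b n = conv b a n.
Proof. by rewrite !(@conv_coef _ _ n.+1) // mulrC. Qed.

Lemma conv_lin (k l : int) (a b c : nat -> int) n :
  conv (fun i => k * a i + l * b i) c n = k * conv a c n + l * conv b c n.
Proof.
rewrite /conv !big_distrr -big_split; apply: eq_bigr => i _ /=.
by ring.
Qed.

Lemma eq_conv (a a' b b' : nat -> int) n :
  a =1 a' -> b =1 b' -> conv a b n = conv a' b' n.
Proof. by move=> ea eb; apply: eq_bigr => i _; rewrite ea eb. Qed.

Definition cbin (n : nat) : int := 'C(n.*2, n)%:Z.

Lemma cbinS n : n.+1%:Z * cbin n.+1 = 2 * (2 * n%:Z + 1) * cbin n.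
Proof.
have E1 := mul_bin_diag n.*2.+1 n.
rewrite /cbin doubleS binS.
have -> : 'C(n.*2.+1, n.+1) = 'C(n.*2.+1, n).
  by rewrite -[RHS]bin_sub; [congr binomial; lia | lia].
have E4 : (n.+1 * 'C(n.*2.+1, n) = n.*2.+1 * 'C(n.*2, n))%N.
  by rewrite (mul_bin_down n.*2.+1 n); congr muln; lia.
lia.
Qed.

Lemma cbin_catalan n : cbin n.+1 - 4 * cbin n = - 2 * (catalan n)%:Z.
Proof.
have E : cbin n = (catalan n)%:Z * n.+1%:Z by rewrite /cbin -catalan_mul PoszM.
apply: (mulfI (_ : n.+1%:Z != 0)) => //.
rewrite mulrBr cbinS E; ring: (intS n).
Qed.

(** By [cbinS] the generating series b satisfies (1 - 4x) b' = 2 b, so its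
    square satisfies (1 - 4x) (b^2)' = 4 b^2. *)
Lemma conv_cbin n : conv cbin cbin n = 4 ^+ n.
Proof.
elim: n => [|n IH]; first by rewrite /conv big_ord1.
(* The coefficients of x b' b are half those of x (b^2)', by symmetry. *)
have half m : 2 * conv (fun i => i%:Z * cbin i) cbin m
              = m%:Z * conv cbin cbin m.
  rewrite mulr_natl mulr2n {2}convC /conv big_distrr -big_split.
  apply: eq_bigr => i _ /=.
  have -> : m%:Z = i%:Z + (m - i)%N%:Z by have := ltn_ord i; lia.
  by ring.
apply: (mulfI (_ : n.+1%:Z != 0)) => //.
rewrite -half conv_recl /= !mul0r add0r.
rewrite (@eq_conv _ (fun i => 4 * (i%:Z * cbin i) + 2 * cbin i) _ cbin) //.
  by rewrite conv_lin exprS -IH mulrDr; move: (half n); rewrite intS; lia.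
by move=> i; rewrite cbinS; ring.
Qed.

(** With A and b the series of a and of the central binomials, and
    A = 1 + x b A, one has b A = b + x A / (1 - 4x); multiplying by 1 - 4x
    leaves (1 - 4x) b, whose coefficients are given by [cbin_catalan]. *)
Lemma cbin_recurrence (a : nat -> int) : a 0%N = 1 ->
  (forall n, a n.+1 = conv cbin a n) ->
  forall n, a n.+2 = 4 * a n.+1 + a n + - 2 * (catalan n)%:Z.
Proof.
move=> a0 aS n.
have vE m : conv cbin a m.+1 = cbin m.+1 + conv (fun i => 4 ^+ i) a m.
  rewrite convC conv_recl a0 mul1r (eq_conv _ aS (frefl _)).
  congr (_ + _); rewrite convC convA; apply: eq_conv => // i.
  exact: conv_cbin.
have powE m : conv (fun i => 4 ^+ i) a m.+1
              = a m.+1 + 4 * conv (fun i => 4 ^+ i) a m.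
  rewrite conv_recl mul1r; congr (_ + _).
  rewrite /conv big_distrr; apply: eq_bigr => i _ /=.
  by rewrite exprS mulrA.
rewrite !aS !vE -cbin_catalan.
case: n => [|n]; last by rewrite powE vE; ring.
by rewrite /conv !big_ord1 a0; ring.
Qed.

(** The linear functional X^m |-> phi m applied to (2 + X)^n; multiplying by
    2 + X gives [bsumS]. *)
Definition bsum (phi : nat -> int) (n : nat) : int :=
  \sum_(m < n.+1) ('C(n, m) * 2 ^ (n - m))%:Z * phi m.

Lemma bsumS phi n :
  bsum phi n.+1 = 2 * bsum phi n + bsum (phi \o succn) n.
Proof.
rewrite /bsum big_ord_recl bin0 mul1n subn0.
under eq_bigr => i _ do rewrite lift0 binS mulnDl PoszD mulrDl subSS.
rewrite big_split /= addrA; congr (_ + _).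
rewrite big_ord_recr /= bin_small // mul0n mul0r addr0.
rewrite [in RHS]big_ord_recl bin0 mul1n subn0 mulrDr expnS PoszM mulrA.
congr (_ + _); rewrite big_distrr; apply: eq_bigr => i _ /=.
rewrite /bump /= add1n mulrA; congr (_ * _).
rewrite -[(n - i)%N]prednK ?subn_gt0 // expnS -subnS; lia.
Qed.

Lemma fE n : f n = bsum (fun m => (odd m * 5 ^ m./2)%:Z) n.+1.
Proof.
rewrite /f /bsum big_mkcond -[in RHS](big_mkord xpredT (fun m =>
  ('C(n.+1, m) * 2 ^ (n.+1 - m))%:Z * (odd m * 5 ^ m./2)%:Z)).
rewrite [RHS]big_ltn // mul0n mulr0 add0r !big_add1; apply: eq_bigr => m _ /=.
case: ifP => oddm; last by rewrite mul0n mulr0.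
by rewrite mul1n uphalf_half (negbTE oddm).
Qed.

Lemma f1 : f 1 = 4.
Proof. by rewrite fE /bsum !big_ord_recl big_ord0. Qed.

Lemma f2 : f 2 = 17.
Proof. by rewrite fE /bsum !big_ord_recl big_ord0. Qed.

(** Here phi vanishes at even m and satisfies phi (m + 2) = 5 phi m: the
    functional factors through X^2 = 5, where 2 + X is a root of
    t^2 = 4 t + 1. *)
Lemma f_recurrence n : f n.+2 = 4 * f n.+1 + f n.
Proof.
pose phi m := (odd m * 5 ^ m./2)%:Z.
have phiSS : bsum ((phi \o succn) \o succn) n.+1 = 5 * bsum phi n.+1.
  rewrite /bsum big_distrr; apply: eq_bigr => i _ /=.
  by rewrite /phi /= negbK expnS; lia.
rewrite !fE -/phi (bsumS phi n.+2) (bsumS (phi \o succn) n.+1).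
rewrite (bsumS phi n.+1) phiSS.
by ring.
Qed.

(** The right-hand side T is the convolution of 1, f 1, f 2, ... with
    1, g 1, g 2, ...; the recurrence of f makes it satisfy the same
    inhomogeneous recurrence as a. *)
Lemma conv_closed_form (a : nat -> int) : a 0%N = 1 ->
  (forall n, a n.+1 = conv cbin a n) ->
  forall n, (2 <= n)%N ->
    a n = f n + g n + \sum_(1 <= m < n) f (n - m)%N * g m.
Proof.
move=> a0 aS.
have a1 : a 1%N = 1 by rewrite aS /conv big_ord1 a0.
have a2 : a 2%N = 3 by rewrite cbin_recurrence // a0 a1.
pose T n := f n + g n + \sum_(1 <= m < n) f (n - m)%N * g m.
have TS n : T n.+3 = 4 * T n.+2 + T n.+1 + - 2 * (catalan n.+1)%:Z.
  rewrite /T (@big_nat_recr _ _ _ n.+2) // (@big_nat_recr _ _ _ n.+1) //=.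
  rewrite [X in 4 * X](_ : _ = f n.+2 + g n.+2 +
    (\sum_(1 <= m < n.+1) f (n.+2 - m)%N * g m + f (n.+2 - n.+1)%N * g n.+1));
    last by rewrite big_nat_recr.
  have -> : \sum_(1 <= m < n.+1) f (n.+3 - m)%N * g m =
      4 * (\sum_(1 <= m < n.+1) f (n.+2 - m)%N * g m) +
      \sum_(1 <= m < n.+1) f (n.+1 - m)%N * g m.
    rewrite big_distrr -big_split; apply: eq_big_nat => m /andP[_ mn] /=.
    by rewrite !subSn ?f_recurrence; [ring | lia..].
  have -> : (n.+3 - n.+2 = 1)%N by lia.
  have -> : (n.+3 - n.+1 = 2)%N by lia.
  have -> : (n.+2 - n.+1 = 1)%N by lia.
  have -> : g n.+3 = - 2 * (catalan n.+1)%:Z by [].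
  by rewrite f1 f2 (f_recurrence n.+1); ring.
have T2 : T 2%N = 3 by rewrite /T big_nat1 f2 f1.
have T1 : T 1%N = 1 by rewrite /T big_geq // f1.
have aT n : a n.+1 = T n.+1 /\ a n.+2 = T n.+2.
  elim: n => [|n [aT1 aT2]]; first by rewrite a1 a2 T1 T2.
  by split; rewrite // cbin_recurrence // TS aT1 aT2.
by case=> // n _; case: (aT n).
Qed.

End Sequences.

Theorem theorem4p1 :
  (forall n : nat, u n.+1 = \sum_(0 <= m < n.+1) 'C(m.*2, m) * u (n - m)) /\
  u 0 = 1 /\
  u 1 = 1 /\
  (forall n : nat, (2 <= n)%N ->
     (u n)%:Z = f n + g n + \sum_(1 <= m < n) f (n - m)%N * g m)%R.
Proof.
have uS n : u n.+1 = \sum_(0 <= m < n.+1) 'C(m.*2, m) * u (n - m).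
  by rewrite u_paths paths_weight01; apply: eq_bigr => m _; rewrite -u_paths.
have u0 : u 0 = 1 by [].
split=> //; split=> //; split=> [|n n2].
  by rewrite uS big_nat1 bin0 mul1n.
apply: (@conv_closed_form (fun n => (u n)%:Z)%R) => // m.
rewrite uS big_mkord /conv /cbin (big_morph Posz PoszD (erefl (Posz 0))).
by apply: eq_bigr => i _; rewrite PoszM.
Qed.
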